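(* For every Brouwer code $b:\mathrm B$, every non-empty complemented subset of the ordinal $[\![b]\!]_{\Sigma^1}$ has a least element. That is, for every $p:[\![b]\!]_{\Sigma^1}\to\mathbf 2$ with $\neg\neg\,\Sigma_x\,(p\,x=0)$ there is a point $x_0$ with $p\,x_0=0$ and $x_0\le x$ for every $x$ with $p\,x=0$.
   Context: Foundation: intensional Martin-Löf type theory as in the HoTT Book, with $\mathbf 0$, $\mathbf 1$ (point $\star$), $\mathbf 2$ (points $0,1$), $\mathbb N$, $+$, $\Pi$, $\Sigma$, universes, univalence (hence function extensionality), propositional truncation and set quotients. No excluded middle is assumed. $f^{-1}(y):=\Sigma_x(f\,x=y)$; an embedding is a map all of whose fibers are propositions (types with at most one element). A complemented subset of $X$ is given by its characteristic function $p:X\to\mathbf 2$, whose roots (points with $p\,x=0$) are its elements; it is non-empty if its type of elements is not empty (doubly negated existence). For an ordinal, the weak order is $x\le y:\equiv\neg(y<x)$. A least element is a member that is $\le$ all members. Ordinals. An ordinal is a type with a proposition-valued, transitive, extensional (elements with the same predecessors are equal), well-founded relation $<$; the same symbol denotes an ordinal and its underlying type. $\mathbf 1$ is an ordinal with the empty order. A topped ordinal is an ordinal with a specified point $t$ such that $\neg(t<y)$ for all $y$; $\mathrm{Ord}^\top$ is their type. For a topped ordinal $\tau$ and $\upsilon:\tau\to\mathrm{Ord}^\top$, $\Sigma_\tau\upsilon$ is the topped ordinal $\Sigma_{x:\tau}\upsilon\,x$ with the lexicographic order: $(x,a)<(x',a')$ iff $x<x'$, or there is $r:x=x'$ such that the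 transport of $a$ along $r$ is below $a'$; its top is the pair of tops. The sum $\tau+\upsilon$ of topped ordinals is the lexicographic sum, over the two-point topped ordinal with underlying type $\mathbf 1+\mathbf 1$ and $\mathrm{inl}\,\star<\mathrm{inr}\,\star$, of the family with members $\tau,\upsilon$. Conaturals: $\mathbb N_\infty:=\Sigma_{u:\mathbf 2^{\mathbb N}}\prod_i u_{i+1}\le u_i$; $\underline n$ is $n$ ones followed by zeros; $\infty$ is constantly $1$; $\iota:\mathbb N\hookrightarrow\mathbb N_\infty$, $\iota\,n=\underline n$. It is a topped ordinal with top $\infty$ under $u<v:\equiv\Sigma_{n:\mathbb N}(u=\underline n)\times(v_n=1)$. Extension: for an embedding $j:X\hookrightarrow K$ and $\alpha:X\to\mathrm{Ord}^\top$, $(\alpha/j)\,k:=\prod_{(x,p):j^{-1}(k)}\alpha\,x$ with order $u<v:\equiv\Sigma_{p:j^{-1}(k)}\,u\,p<v\,p$ and top the function assigning tops. Brouwer codes: $\mathrm B$ is the inductive type with constructors $\mathsf Z:\mathrm B$, $\mathsf S:\mathrm B\to\mathrm B$, $\mathsf L:(\mathbb N\to\mathrm B)\to\mathrm B$. The interpretation $[\![-]\!]_{\Sigma^1}:\mathrm B\to\mathrm{Ord}^\top$ is defined by induction: $\mathsf Z\mapsto\mathbf 1$; $\mathsf S\,b\mapsto[\![b]\!]_{\Sigma^1}+\mathbf 1$; $\mathsf L\,b\mapsto\Sigma_{\mathbb N_\infty}\big((n\mapsto[\![b\,n]\!]_{\Sigma^1})/\iota\big)$. *)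

(* Defs.v *)
From Stdlib Require Import Arith Lia Bool FunctionalExtensionality.
Import EqNotations.

(** Conventions.  The development is in homotopy type theory, so everything is
    proof-relevant: orders are valued in [Type], existence is [sigT],
    disjunction is [sum], conjunction is [prod] and negation is [notT].  Rocq's
    [eq] is the identity type (neither UIP, proof irrelevance nor excluded
    middle is used).  Of univalence, only its consequence function
    extensionality is needed, and it is taken from the standard library.
    The type 2 is [bool], with 0 = [false] and 1 = [true]. *)

Definition is_prop (A : Type) : Type := forall a b : A, a = b.

Definition is_set (A : Type) : Type := forall x y : A, is_prop (x = y).

Definition fiber {X Y : Type} (f : X -> Y) (y : Y) : Type := {x : X & f x = y}.

Definition is_embedding {X Y : Type} (f : X -> Y) : Type :=
  forall y : Y, is_prop (fiber f y).

(** The [Type]-valued analogue of [Acc]. *)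
Inductive acc {A : Type} (lt : A -> A -> Type) (x : A) : Type :=
  acc_intro : (forall y, lt y x -> acc lt y) -> acc lt x.

Record is_ordinal_order {A : Type} (lt : A -> A -> Type) : Type := {
  order_prop : forall x y, is_prop (lt x y);
  order_trans : forall x y z, lt x y -> lt y z -> lt x z;
  order_ext : forall x y,
    (forall z, (lt z x -> lt z y) * (lt z y -> lt z x)) -> x = y;
  order_wf : forall x, acc lt x
}.

Record ordinal : Type := {
  carrier :> Type;
  olt : carrier -> carrier -> Type;
  lt_ordinal : is_ordinal_order olt
}.

Arguments olt {_} _ _.

Definition ole {A : ordinal} (x y : A) : Type := notT (olt y x).

Record topped_ordinal : Type := {
  ord :> ordinal;
  top : ord;
  top_spec : forall y : ord, notT (olt top y)
}.

Arguments top {_}.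

Lemma is_set_of_prop_relation {A : Type} (R : A -> A -> Type)
  (R_prop : forall x y, is_prop (R x y))
  (R_refl : forall x, R x x)
  (R_eq : forall x y, R x y -> x = y) : is_set A.
Proof.
  intros x y.
  set (c := fun z (q : x = z) => R_eq x z (rew [R x] q in R_refl x)).
  assert (H : forall z (q : x = z), q = eq_trans (eq_sym (c x eq_refl)) (c z q)).
  { intros z q; destruct q; destruct (c x eq_refl); reflexivity. }
  intros p q; rewrite (H y p), (H y q); unfold c.
  now rewrite (R_prop x y (rew [R x] p in R_refl x) (rew [R x] q in R_refl x)).
Qed.

Lemma is_prop_forall {A : Type} (B : A -> Type) :
  (forall x, is_prop (B x)) -> is_prop (forall x, B x).
Proof.
  intros H f g; apply functional_extensionality_dep; intro x; apply H.
Qed.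

Lemma is_prop_prod (A B : Type) : is_prop A -> is_prop B -> is_prop (A * B).
Proof. intros HA HB [a b] [a' b']; now rewrite (HA a a'), (HB b b'). Qed.

Lemma is_prop_sigT {A : Type} (B : A -> Type) :
  is_prop A -> (forall x, is_prop (B x)) -> is_prop {x : A & B x}.
Proof.
  intros HA HB [a b] [a' b']; destruct (HA a a'); now rewrite (HB a b b').
Qed.

Lemma is_set_bool : is_set bool.
Proof. intros x y p q; apply Eqdep_dec.UIP_dec, bool_dec. Qed.

Lemma is_set_nat : is_set nat.
Proof. intros x y p q; apply Eqdep_dec.UIP_dec, Nat.eq_dec. Qed.

Lemma acc_irrefl {A : Type} (lt : A -> A -> Type) (x : A) :
  acc lt x -> notT (lt x x).
Proof. induction 1 as [x _ IH]; intro h; exact (IH x h h). Qed.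

Lemma lt_irrefl {A : ordinal} (x : A) : notT (olt x x).
Proof. apply acc_irrefl, (order_wf _ (lt_ordinal A)). Qed.

Lemma is_set_ordinal (A : ordinal) : is_set A.
Proof.
  pose proof (lt_ordinal A) as [HP _ HE _].
  apply (is_set_of_prop_relation
    (fun x y : A => forall z, (olt z x -> olt z y) * (olt z y -> olt z x))).
  - intros x y; apply is_prop_forall; intro z.
    apply is_prop_prod; apply is_prop_forall; intro; apply HP.
  - intros x z; split; exact (fun h => h).
  - exact HE.
Qed.

Definition one_lt (x y : unit) : Type := Empty_set.

Lemma one_lt_ordinal : is_ordinal_order one_lt.
Proof.
  split.
  - intros x y [].
  - intros x y z [].
  - intros [] [] _; reflexivity.
  - intro x; constructor; intros y [].
Qed.

Definition one : topped_ordinal :=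
  {| ord := {| carrier := unit; olt := one_lt; lt_ordinal := one_lt_ordinal |};
     top := tt;
     top_spec := fun y (h : one_lt tt y) => match h with end |}.

Definition two_lt (x y : unit + unit) : Type :=
  match x, y with
  | inl _, inr _ => unit
  | _, _ => Empty_set
  end.

Lemma two_lt_ordinal : is_ordinal_order two_lt.
Proof.
  split.
  - intros [[]|[]] [[]|[]] a b; simpl in *; destruct a, b; reflexivity.
  - intros [[]|[]] [[]|[]] [[]|[]]; simpl; intros; tauto.
  - intros [[]|[]] [[]|[]] H; try reflexivity; exfalso.
    + destruct (snd (H (inl tt)) tt).
    + destruct (fst (H (inl tt)) tt).
  - assert (H0 : forall u, acc two_lt (inl u)).
    { intro u; constructor; intros [[]|[]] h; destruct h. }
    intros [u|u]; [apply H0|].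
    constructor; intros [v|v] h; [apply H0|destruct h].
Qed.

Lemma two_top_spec (y : unit + unit) : notT (two_lt (inr tt) y).
Proof. intro h; destruct h. Qed.

Definition two : topped_ordinal :=
  {| ord := {| carrier := unit + unit; olt := two_lt;
               lt_ordinal := two_lt_ordinal |};
     top := inr tt;
     top_spec := two_top_spec |}.

Section Lexicographic.
  Variables (T : topped_ordinal) (U : T -> topped_ordinal).

  Definition lex_lt (s s' : {x : T & U x}) : Type :=
    let (x, a) := s in
    let (x', a') := s' in
    (olt x x' + {r : x = x' & olt (rew [fun z => U z] r in a) a'})%type.

  Lemma lex_lt_ordinal : is_ordinal_order lex_lt.
  Proof.
    pose proof (lt_ordinal T) as [TP TT TE TW].
    pose proof (is_set_ordinal T) as TS.
    split.
    - intros [x a] [x' a'] [h|[r h]] [k|[s k]].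
      + now rewrite (TP _ _ h k).
      + exfalso; destruct s; exact (lt_irrefl x h).
      + exfalso; destruct r; exact (lt_irrefl x k).
      + destruct (TS _ _ r s).
        now rewrite (order_prop _ (lt_ordinal (U x')) _ _ h k).
    - intros [x a] [y b] [z c] [h|[r h]] [k|[s k]].
      + left; exact (TT _ _ _ h k).
      + destruct s; left; exact h.
      + destruct r; left; exact k.
      + destruct r, s; right; exists eq_refl.
        exact (order_trans _ (lt_ordinal (U x)) _ _ _ h k).
    - intros [x a] [y b] H.
      assert (e : x = y).
      { apply TE; intro z; split; intro h.
        - destruct (fst (H (existT _ z (top : U z))) (inl h)) as [k|[r k]];
            [exact k|].
          destruct r; destruct (top_spec _ _ k).
        - destruct (snd (H (existT _ z (top : U z))) (inl h)) as [k|[r k]];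
            [exact k|].
          destruct r; destruct (top_spec _ _ k). }
      destruct e.
      assert (e : a = b).
      { apply (order_ext _ (lt_ordinal (U x))); intro c; split; intro h.
        - destruct (fst (H (existT _ x c)) (inr (existT _ eq_refl h)))
            as [k|[r k]]; [destruct (lt_irrefl _ k)|].
          rewrite (TS _ _ r eq_refl) in k; exact k.
        - destruct (snd (H (existT _ x c)) (inr (existT _ eq_refl h)))
            as [k|[r k]]; [destruct (lt_irrefl _ k)|].
          rewrite (TS _ _ r eq_refl) in k; exact k. }
      now destruct e.
    - intros [x a]; revert a; induction (TW x) as [x _ IHx]; intro a.
      induction (order_wf _ (lt_ordinal (U x)) a) as [a _ IHa].
      constructor; intros [y b] [h|[r h]].
      + apply IHx, h.
      + destruct r; apply IHa, h.
  Qed.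

  Definition lex_top : {x : T & U x} := existT _ top top.

  Lemma lex_top_spec (s : {x : T & U x}) : notT (lex_lt lex_top s).
  Proof.
    destruct s as [x a]; intros [h|[r h]]; [exact (top_spec _ _ h)|].
    destruct r; exact (top_spec _ _ h).
  Qed.

  Definition sigma : topped_ordinal :=
    {| ord := {| carrier := {x : T & U x}; olt := lex_lt;
                 lt_ordinal := lex_lt_ordinal |};
       top := lex_top;
       top_spec := lex_top_spec |}.
End Lexicographic.

Definition plus (T U : topped_ordinal) : topped_ordinal :=
  sigma two (fun i : unit + unit => match i with inl _ => T | inr _ => U end).

Section Extension.
  Variables (X K : Type) (j : X -> K) (j_emb : is_embedding j).
  Variables (alpha : X -> topped_ordinal) (k : K).

  Definition ext_carrier : Type := forall f : fiber j k, alpha (projT1 f).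

  Definition ext_lt (u v : ext_carrier) : Type := {f : fiber j k & olt (u f) (v f)}.

  Lemma ext_lt_ordinal : is_ordinal_order ext_lt.
  Proof.
    assert (FS : is_set (fiber j k)).
    { apply (is_set_of_prop_relation (fun _ _ => unit)).
      - intros _ _ [] []; reflexivity.
      - intros; exact tt.
      - intros x y _; apply j_emb. }
    split.
    - intros u v; apply is_prop_sigT; [apply j_emb|].
      intro f; apply (order_prop _ (lt_ordinal (alpha (projT1 f)))).
    - intros u v w [f h] [g h']; exists f; destruct (j_emb k f g).
      exact (order_trans _ (lt_ordinal (alpha (projT1 f))) _ _ _ h h').
    - intros u v H; apply functional_extensionality_dep; intro f.
      apply (order_ext _ (lt_ordinal (alpha (projT1 f)))); intro a.
      pose (w := (fun g => rew [fun g => alpha (projT1 g)] (j_emb k f g) in a)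
                 : ext_carrier).
      assert (e : w f = a).
      { unfold w; now rewrite (FS _ _ (j_emb k f f) eq_refl). }
      split; intro h; rewrite <- e in h |- *.
      + destruct (fst (H w) (existT _ f h)) as [g h'].
        destruct (j_emb k f g); exact h'.
      + destruct (snd (H w) (existT _ f h)) as [g h'].
        destruct (j_emb k f g); exact h'.
    - assert (H : forall f (a : alpha (projT1 f)),
                  acc olt a -> forall u : ext_carrier, u f = a -> acc ext_lt u).
      { induction 1 as [a _ IH]; intros u e.
        constructor; intros v [g h]; destruct (j_emb k f g).
        rewrite e in h; exact (IH _ h v eq_refl). }
      intro u; constructor; intros v [f _].
      exact (H f _ (order_wf _ (lt_ordinal (alpha (projT1 f))) (v f)) v eq_refl).
  Qed.

  Definition ext_top : ext_carrier := fun _ => top.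

  Lemma ext_top_spec (u : ext_carrier) : notT (ext_lt ext_top u).
  Proof. intros [f h]; exact (top_spec _ _ h). Qed.

  Definition extension : topped_ordinal :=
    {| ord := {| carrier := ext_carrier; olt := ext_lt;
                 lt_ordinal := ext_lt_ordinal |};
       top := ext_top;
       top_spec := ext_top_spec |}.
End Extension.

Arguments extension {X K} j j_emb alpha k.

Definition conat : Type := {u : nat -> bool & forall i, Bool.le (u (S i)) (u i)}.

Definition digit (u : conat) (i : nat) : bool := projT1 u i.

Lemma is_prop_bool_le (a b : bool) : is_prop (Bool.le a b).
Proof.
  destruct a; simpl; [apply is_set_bool|intros [] []; reflexivity].
Qed.

Lemma conat_ext (u v : conat) : (forall i, digit u i = digit v i) -> u = v.
Proof.
  destruct u as [u hu], v as [v hv]; cbn; intro H.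
  assert (e : u = v) by (apply functional_extensionality; exact H).
  destruct e; f_equal; apply is_prop_forall; intro; apply is_prop_bool_le.
Qed.

Lemma is_set_conat : is_set conat.
Proof.
  apply (is_set_of_prop_relation (fun u v => forall i, digit u i = digit v i)).
  - intros u v; apply is_prop_forall; intro; apply is_set_bool.
  - reflexivity.
  - apply conat_ext.
Qed.

Lemma iota_decreasing (n i : nat) : Bool.le (S i <? n) (i <? n).
Proof.
  destruct (Nat.ltb_spec (S i) n); cbn; [apply Nat.ltb_lt; lia|exact I].
Qed.

Definition iota (n : nat) : conat := existT _ (fun i => i <? n) (iota_decreasing n).

Definition infinity : conat := existT _ (fun _ => true) (fun _ => eq_refl).

Lemma iota_inj (n m : nat) : iota n = iota m -> n = m.
Proof.
  intro e.
  assert (H : forall i, (i <? n) = (i <? m)).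
  { intro i; exact (f_equal (fun u => digit u i) e). }
  pose proof (H n) as Hn; pose proof (H m) as Hm.
  rewrite Nat.ltb_irrefl in Hn, Hm.
  symmetry in Hn; apply Nat.ltb_ge in Hn, Hm; lia.
Qed.

Lemma iota_embedding : is_embedding iota.
Proof.
  intros u [n p] [m q].
  destruct (iota_inj n m (eq_trans p (eq_sym q))).
  now rewrite (is_set_conat _ _ p q).
Qed.

Definition conat_lt (u v : conat) : Type :=
  {n : nat & ((u = iota n) * (digit v n = true))%type}.

Lemma digit_decreasing (u : conat) (n m : nat) :
  n <= m -> digit u m = true -> digit u n = true.
Proof.
  destruct u as [u hu]; cbn; induction 1 as [|m _ IH]; intro h; [exact h|].
  apply IH; pose proof (hu m) as hm; now rewrite h in hm.
Qed.

Lemma conat_lt_ordinal : is_ordinal_order conat_lt.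
Proof.
  split.
  - intros u v [n [p h]] [m [q h']].
    destruct (iota_inj n m (eq_trans (eq_sym p) q)).
    now rewrite (is_set_conat _ _ p q), (is_set_bool _ _ h h').
  - intros u v w [n [p h]] [m [q h']]; exists n; split; [exact p|].
    apply (digit_decreasing w n m); [|exact h'].
    rewrite q in h; apply Nat.ltb_lt in h; lia.
  - intros u v H; apply conat_ext; intro i.
    destruct (digit u i) eqn:Eu, (digit v i) eqn:Ev; try reflexivity; exfalso.
    + destruct (fst (H (iota i)) (existT _ i (eq_refl, Eu))) as [n [p h]].
      apply iota_inj in p; congruence.
    + destruct (snd (H (iota i)) (existT _ i (eq_refl, Ev))) as [n [p h]].
      apply iota_inj in p; congruence.
  - assert (H : forall N n, n < N -> acc conat_lt (iota n)).
    { induction N as [|N IH]; intros n hn; [lia|].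
      constructor; intros u [m [p h]]; rewrite p; apply IH.
      apply Nat.ltb_lt in h; lia. }
    intro u; constructor; intros v [n [p _]]; rewrite p.
    exact (H (S n) n (Nat.lt_succ_diag_r n)).
Qed.

Lemma infinity_spec (u : conat) : notT (conat_lt infinity u).
Proof.
  intros [n [p _]].
  assert (h : true = (n <? n)) by exact (f_equal (fun u => digit u n) p).
  rewrite Nat.ltb_irrefl in h; discriminate.
Qed.

Definition conat_ordinal : topped_ordinal :=
  {| ord := {| carrier := conat; olt := conat_lt; lt_ordinal := conat_lt_ordinal |};
     top := infinity;
     top_spec := infinity_spec |}.

Inductive brouwer : Type :=
| BZ : brouwer
| BS : brouwer -> brouwer
| BL : (nat -> brouwer) -> brouwer.

Fixpoint interp (b : brouwer) : topped_ordinal :=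
  match b with
  | BZ => one
  | BS b => plus (interp b) one
  | BL b =>
      sigma conat_ordinal
        (extension iota iota_embedding (fun n => interp (b n)))
  end.

Definition elements {X : Type} (p : X -> bool) : Type := {x : X & p x = false}.

Definition nonempty {X : Type} (p : X -> bool) : Type := notT (notT (elements p)).

Definition least_element {A : ordinal} (p : A -> bool) : Type :=
  {x0 : A & ((p x0 = false) * (forall x : A, p x = false -> ole x0 x))%type}.

(* Main.v *)
Require Import Defs.
From Stdlib Require Import Arith Lia FunctionalExtensionality.
Import EqNotations.

(** The statement cannot be proved by induction on codes as it stands: without
    excluded middle, the induction hypothesis for a summand could only be
    applied after deciding whether the given complemented subset meets that
    summand.  The induction therefore carries a stronger, unconditional
    property, [has_minimum_selector]: every decidable subset [p] comes with a
    point [x0] such that, as soon as [p] has any root at all, [x0] is a least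
    root.  The point is available before anything is known about [p], and
    evaluating [p x0] decides whether [p] has a root.

    This property holds for the one-point and two-point ordinals and is
    preserved by the constructions interpreting the codes.
    - For a lexicographic sum ([sigma_selector]), selecting in every summand
      turns a subset of the sum into a decidable subset of the index ordinal,
      in which one selects again.
    - For the conaturals ([conat_selector]), the selected point counts the
      finite points preceding the first root; it is infinity when no finite
      point is a root.
    - For an extension along an embedding ([extension_selector]), the product
      is indexed by a proposition.  It is equivalent to any factor as soon as
      the index is inhabited, and has a single point when the index is empty;
      the selection is made uniformly, without deciding which case holds.

    Finally, if [p] is only known to be non-empty, the equation
    [p x0 = false] still follows, because equality in [bool] is decidable and
    hence stable under double negation. *)

Definition has_minimum_selector (A : ordinal) : Type :=
  forall p : A -> bool,
    {x0 : A & forall x, p x = false -> ((p x0 = false) * ole x0 x)%type}.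

(** Non-emptiness suffices because the conclusion [p x0 = false] is stable
    under double negation; minimality only ever speaks of actual roots. *)
Lemma least_element_of_selector (A : ordinal) (p : A -> bool) :
  has_minimum_selector A -> nonempty p -> least_element p.
Proof.
  intros sel hp; destruct (sel p) as [x0 h]; exists x0; split.
  - destruct (p x0) eqn:E; [exfalso|reflexivity].
    assert (no : notT (elements p)).
    { intros [x hx]; destruct (h x hx) as [h0 _]; discriminate. }
    destruct (hp no).
  - intros x hx; exact (snd (h x hx)).
Qed.

Lemma one_selector : has_minimum_selector one.
Proof.
  intro p; exists tt; intros [] h; split; [exact h|intros []].
Qed.

Lemma two_selector : has_minimum_selector two.
Proof.
  intro p; destruct (p (inl tt)) eqn:E.
  - exists (inr tt); intros [[]|[]] h; [congruence|].
    split; [exact h|intros []].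
  - exists (inl tt); intros x _; split; [exact E|].
    destruct x as [[]|[]]; intros [].
Qed.

(** With [a x] the point selected in the summand at [x], the slice of [p] at
    [x] has a root exactly when [p (x, a x)] vanishes; the latter condition on
    [x] is decidable, so the selector of the index ordinal applies to it. *)
Lemma sigma_selector (T : topped_ordinal) (U : T -> topped_ordinal) :
  has_minimum_selector T -> (forall x, has_minimum_selector (U x)) ->
  has_minimum_selector (sigma T U).
Proof.
  intros selT selU p.
  pose (inner := fun x => selU x (fun a => p (existT _ x a))).
  pose (a := fun x => projT1 (inner x)).
  destruct (selT (fun x => p (existT _ x (a x)))) as [x0 h0].
  exists (existT _ x0 (a x0)); intros [x b] hb.
  destruct (h0 x (fst (projT2 (inner x) b hb))) as [root min].
  split; [exact root|].
  intros [k|[r k]]; [exact (min k)|].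
  destruct r; exact (snd (projT2 (inner x) b hb) k).
Qed.

Fixpoint all_true_upto (q : nat -> bool) (n : nat) : bool :=
  match n with
  | O => q 0
  | S m => all_true_upto q m && q (S m)
  end.

Lemma all_true_upto_decreasing (q : nat -> bool) (n : nat) :
  Bool.le (all_true_upto q (S n)) (all_true_upto q n).
Proof.
  cbn; destruct (all_true_upto q n), (q (S n)); cbn; exact I || reflexivity.
Qed.

Lemma all_true_upto_last (q : nat -> bool) (n : nat) :
  all_true_upto q n = true -> q n = true.
Proof.
  destruct n; cbn; [easy|]; intro h; now apply andb_prop in h.
Qed.

(** The position of the first [false] in [q], with infinity when there is
    none; it is computed without searching. *)
Definition first_false (q : nat -> bool) : conat :=
  existT _ (all_true_upto q) (all_true_upto_decreasing q).

Lemma eq_iota (u : conat) (n : nat) :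
  (forall i, i < n -> digit u i = true) -> digit u n = false -> u = iota n.
Proof.
  intros ones zero; apply conat_ext; intro i.
  change (digit (iota n) i) with (i <? n).
  destruct (Nat.ltb_spec i n) as [hi|hi]; [exact (ones i hi)|].
  destruct (digit u i) eqn:E; [|reflexivity].
  apply (digit_decreasing u n i hi) in E; congruence.
Qed.

Lemma first_false_attained (q : nat -> bool) (n : nat) :
  all_true_upto q n = false ->
  {m : nat & ((q m = false) * (first_false q = iota m))%type}.
Proof.
  induction n as [|n IH]; intro h.
  - exists 0; split; [exact h|].
    apply eq_iota; [lia|exact h].
  - destruct (all_true_upto q n) eqn:En; [|exact (IH eq_refl)].
    exists (S n); split; [cbn in h; now rewrite En in h|].
    apply eq_iota; [intros i hi|exact h].
    apply (digit_decreasing (first_false q) i n); [lia|exact En].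
Qed.

(** Without excluded middle, a conatural need not be known to be finite or
    infinite, but no decidable subset can tell the difference: a conatural
    distinct from every finite one has no first zero digit, hence is
    infinity. *)
Lemma conat_density (p : conat -> bool) :
  (forall n, p (iota n) = true) -> p infinity = true ->
  forall u, p u = true.
Proof.
  intros fin inf u; destruct (p u) eqn:E; [reflexivity|].
  assert (notfin : forall n, u <> iota n).
  { intros n e; rewrite e, fin in E; discriminate. }
  assert (ones : forall n, digit u n = true).
  { induction n as [|n IH].
    - destruct (digit u 0) eqn:D; [reflexivity|destruct (notfin 0)].
      apply eq_iota; [lia|exact D].
    - destruct (digit u (S n)) eqn:D; [reflexivity|destruct (notfin (S n))].
      apply eq_iota; [intros i hi|exact D].
      apply (digit_decreasing u i n); [lia|exact IH]. }
  assert (e : u = infinity) by (apply conat_ext; exact ones).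
  congruence.
Qed.

(** Let [u0] be the position of the first finite root, infinity by default.  If [p u0 = true] then
    no finite point is a root, for otherwise [u0] would be one; hence [u0] is
    infinity and, by density, there are no roots at all.  This is Escardó's
    argument that the conaturals can be searched.  Minimality is immediate
    because a point below [u0] is some [iota n] on which [p] was seen to be
    [true]. *)
Lemma conat_selector : has_minimum_selector conat_ordinal.
Proof.
  intro p; change (conat -> bool) in p.
  pose (q := fun n => p (iota n)).
  exists (first_false q); intros u hu; split.
  - destruct (p (first_false q)) eqn:E; [exfalso|reflexivity].
    assert (all : forall n, all_true_upto q n = true).
    { intro n; destruct (all_true_upto q n) eqn:D; [reflexivity|].
      destruct (first_false_attained q n D) as [m [hm e]].
      rewrite e in E; unfold q in hm; congruence. }
    assert (e : first_false q = infinity) by (apply conat_ext; exact all).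
    rewrite e in E.
    pose proof (conat_density p
      (fun n => all_true_upto_last q n (all n)) E u); congruence.
  - intros [n [e d]].
    apply (all_true_upto_last q) in d; unfold q in d; congruence.
Qed.

Section Extension_selector.
  Variables (X K : Type) (j : X -> K) (j_emb : is_embedding j).
  Variables (alpha : X -> topped_ordinal) (k : K).

  (** As the fiber is a proposition, a value at one of its points determines a
      section. *)
  Definition spread (f : fiber j k) (a : alpha (projT1 f)) :
    extension j j_emb alpha k :=
    fun g => rew [fun g => alpha (projT1 g)] (j_emb k f g) in a.

  Lemma spread_eval (u : extension j j_emb alpha k) (f : fiber j k) :
    spread f (u f) = u.
  Proof.
    apply functional_extensionality_dep; intro g; unfold spread.
    now destruct (j_emb k f g).
  Qed.

  (** The selected section [u0] takes at [f] the point selected for [p]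
      transported to the factor at [f].  To see that [u0] is a root when [u]
      is, suppose that it is not: then the fiber is empty, since at any [f] the
      selection would make [u0] a root; but over an empty fiber [u0 = u].
      This refutes the assumption without deciding whether the fiber is
      inhabited. *)
  Lemma extension_selector :
    (forall x, has_minimum_selector (alpha x)) ->
    has_minimum_selector (extension j j_emb alpha k).
  Proof.
    intros sel p.
    pose (inner := fun f => sel (projT1 f) (fun a => p (spread f a))).
    pose (u0 := (fun f => projT1 (inner f)) : extension j j_emb alpha k).
    exists u0; intros u hu.
    assert (hspread : forall f, p (spread f (u f)) = false).
    { intro f; now rewrite spread_eval. }
    split.
    - destruct (p u0) eqn:E; [exfalso|reflexivity].
      assert (empty : notT (fiber j k)).
      { intro f.
        pose proof (fst (projT2 (inner f) (u f) (hspread f))) as h.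
        change (p (spread f (u0 f)) = false) in h.
        rewrite spread_eval in h; congruence. }
      assert (e : u0 = u).
      { apply functional_extensionality_dep; intro f; destruct (empty f). }
      congruence.
    - intros [f h]; exact (snd (projT2 (inner f) (u f) (hspread f)) h).
  Qed.
End Extension_selector.

Lemma plus_selector (T U : topped_ordinal) :
  has_minimum_selector T -> has_minimum_selector U ->
  has_minimum_selector (plus T U).
Proof.
  intros selT selU; apply sigma_selector; [exact two_selector|].
  intros [i|i]; assumption.
Qed.

Lemma interp_selector (b : brouwer) : has_minimum_selector (interp b).
Proof.
  induction b as [|b IH|b IH].
  - exact one_selector.
  - exact (plus_selector _ _ IH one_selector).
  - apply sigma_selector; [exact conat_selector|].
    intro u; apply extension_selector; exact IH.
Qed.

Theorem corollary6p31 (b : brouwer) (p : interp b -> bool) (hp : nonempty p) :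
  least_element p.
Proof.
  exact (least_element_of_selector _ p (interp_selector b) hp).
Qed.
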